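(* Suppose a function $V:\mathbb{R}^n\rightarrow\mathbb{R}$ satisfies $V(0)=0$ and $V(x)>0$ for all $x\neq 0$. If $V$ is convex, then it is radially unbounded.
   Context: A function $V:\mathbb{R}^n\to\mathbb{R}$ is radially unbounded if $V(x)\to\infty$ as $\|x\|\to\infty$. *)

(* Defs.v *)
From HB Require Import structures.
From mathcomp Require Import all_boot all_order all_algebra.
From mathcomp Require Import all_classical all_reals all_analysis.

Set Implicit Arguments.
Unset Strict Implicit.
Unset Printing Implicit Defensive.

Import Order.TTheory GRing.Theory Num.Theory.
Import numFieldNormedType.Exports.

Local Open Scope classical_set_scope.
Local Open Scope ring_scope.

(* The canonical norm of 'rV[R]_n is the sup norm, hence the explicit
   Euclidean norm. *)
Definition enorm (R : realType) (n : nat) (x : 'rV[R]_n) : R :=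
  Num.sqrt (\sum_(i < n) x ord0 i ^+ 2).

(* The filter "||x|| tends to +oo" on R^n; it is not proper when n = 0. *)
Definition enorm_pinfty (R : realType) (n : nat) : set_system 'rV[R]_n :=
  filter_from [set: R] (fun r => [set x | r < enorm x]).

Global Instance enorm_pinfty_filter (R : realType) (n : nat) :
  Filter (@enorm_pinfty R n).
Proof.
apply: filter_from_filter; first by exists 0.
move=> r s _ _; exists (Num.max r s) => // x /=.
by rewrite gt_max => /andP[].
Qed.

Definition radially_unbounded (R : realType) (n : nat) (V : 'rV[R]_n -> R) :
    Prop :=
  V x @[x --> @enorm_pinfty R n] --> +oo.

Lemma radially_unboundedP (R : realType) (n : nat) (V : 'rV[R]_n -> R) :
  radially_unbounded V <->
  forall M : R, exists r : R, forall x, r < enorm x -> M < V x.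
Proof.
split=> [cV M|cV A [M [_ MA]]].
  have [r _ rM] : enorm_pinfty [set x | M < V x].
    by apply: (cV [set y | M < y]); exists M; split; rewrite ?num_real.
  by exists r => x /rM.
by have [r rM] := cV M; exists r => // x /rM /MA.
Qed.

(* Main.v *)
(* By convexity and V 0 = 0, V x >= |x| V(x/|x|) for |x| >= 1, so it suffices
   to bound V below by a positive constant on the unit sphere of the sup norm.
   A finite convex function on R^n is bounded above on balls, which forces it
   to be locally bounded away from 0 at every point where it is positive;
   compactness of the sphere makes the bound uniform. *)
Require Import Defs.
From HB Require Import structures.
From mathcomp Require Import all_boot all_order all_algebra.
From mathcomp Require Import all_classical all_reals all_analysis.
From mathcomp Require Import ring lra.

Set Implicit Arguments.
Unset Strict Implicit.
Unset Printing Implicit Defensive.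

Import Order.TTheory GRing.Theory Num.Theory.
Import numFieldNormedType.Exports.

Local Open Scope classical_set_scope.
Local Open Scope ring_scope.

Lemma convex_functionT_le (R : realType) (E : lmodType R) (f : E -> R)
    (a b : R) (x y : E) :
  convex_function [set: E] f -> 0 <= a -> 0 <= b -> a + b = 1 ->
  f (a *: x + b *: y) <= a * f x + b * f y.
Proof.
move=> cf a0 b0 ab1; have a1 : a <= 1 by rewrite -ab1 lerDl.
have := cf (Itv01 a0 a1) x y (in_setT _) (in_setT _).
rewrite convRE /conv /= /unstable.onem.
by rewrite (_ : 1 - a = b) // -ab1 addrC addKr.
Qed.

(** The point [t *: v] is the average of the two endpoints with weights [(r + t) / (2 * r)] and
    [(r - t) / (2 * r)]. *)
Lemma convex_segment_le (R : realType) (E : lmodType R) (f : E -> R)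
    (r : R) (v : E) :
  convex_function [set: E] f -> 0 < r ->
  forall t, `|t| <= r -> f (t *: v) <= Num.max (f (r *: v)) (f (- r *: v)).
Proof.
move=> cf r0 t; rewrite ler_norml => /andP[rt tr].
pose a := (r + t) / (2 * r); pose b := (r - t) / (2 * r).
have r2 : 0 < 2 * r by rewrite mulr_gt0.
have a0 : 0 <= a by rewrite divr_ge0 //; lra.
have b0 : 0 <= b by rewrite divr_ge0 //; lra.
have ab1 : a + b = 1 by rewrite /a /b; field; lra.
have -> : t *: v = a *: (r *: v) + b *: (- r *: v).
  by rewrite !scalerA -scalerDl; congr (_ *: _); rewrite /a /b; field; lra.
apply: le_trans (convex_functionT_le _ _ cf a0 b0 ab1) _.
rewrite -[leRHS]mul1r -ab1 mulrDl.
by rewrite lerD // ler_wpM2l // le_max lexx ?orbT.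
Qed.

(** Coordinates are peeled off one at a time: [u + w] is the midpoint of [2 u] and [2 w], which
    separates one axis, where the segment bound applies, from the remaining ones. *)
Lemma convex_bounded_above (R : realType) (n : nat) (f : 'rV[R]_n -> R)
    (r : R) :
  convex_function [set: 'rV[R]_n] f -> 0 < r ->
  exists C, forall x, `|x| <= r -> f x <= C.
Proof.
move=> cf r0.
(* The radius [q] is quantified inside the induction because each midpoint doubles it. *)
have sum_bounded (s : seq 'I_n) : forall q : R, 0 < q ->
    exists C, forall u : 'I_n -> R, (forall i, `|u i| <= q) ->
      f (\sum_(i <- s) u i *: 'e_i) <= C.
  elim: s => [|j s IHs] q q0.
    by exists (f 0) => u _; rewrite big_nil.
  have q20 : 0 < 2 * q by rewrite mulr_gt0.
  have [C fC] := IHs _ q20.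
  set D := Num.max (f ((2 * q) *: 'e_j)) (f (- (2 * q) *: 'e_j)).
  exists (2^-1 * D + 2^-1 * C) => u uq.
  have uq2 i : `|2 * u i| <= 2 * q by rewrite normrM ger0_norm // ler_pM2l.
  have -> : \sum_(i <- j :: s) u i *: 'e_i =
      2^-1 *: ((2 * u j) *: 'e_j) +
      2^-1 *: \sum_(i <- s) (2 * u i) *: ('e_i : 'rV[R]_n).
    rewrite big_cons scaler_sumr scalerA mulKf ?pnatr_eq0//; congr (_ + _).
    by apply: eq_bigr => i _; rewrite scalerA mulKf ?pnatr_eq0.
  apply: le_trans (convex_functionT_le _ _ cf _ _ _) _; [lra..|].
  rewrite lerD // ler_wpM2l ?invr_ge0 //; last exact: fC.
  exact: convex_segment_le.
have [C fC] := sum_bounded (index_enum 'I_n) r r0.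
exists C => x xr; rewrite [x]row_sum_delta; apply: fC => i.
apply: le_trans xr; rewrite [`|x|]mx_normrE.
by rewrite (le_bigmax _ (fun ij => `|x ij.1 ij.2|) (ord0, i)).
Qed.

(* If x is close to p then p lies on a short initial part of a segment
   from x to a point y of a fixed ball, on which f is bounded above;
   convexity on that segment bounds f x below. *)
Lemma convex_pos_near (R : realType) (n : nat) (f : 'rV[R]_n -> R)
    (p : 'rV[R]_n) :
  convex_function [set: 'rV[R]_n] f -> 0 < f p ->
  exists2 m, 0 < m & \forall x \near p, m <= f x.
Proof.
move=> cf fp0.
have r0 : 0 < `|p| + 2 by rewrite ltr_wpDl.
have [C0 fC0] := convex_bounded_above cf r0.
(* Including [f p] in the maximum makes [C] positive and, below, [d < 1]. *)
pose C := Num.max C0 (f p).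
have fC x : `|x| <= `|p| + 2 -> f x <= C.
  by move=> /fC0 /le_trans; apply; rewrite le_max lexx.
have fpC : f p <= C by rewrite le_max lexx orbT.
have C_gt0 : 0 < C by exact: lt_le_trans fpC.
(* This weight lets the far endpoint [y] contribute at most [d * C = f p / 2], leaving the other
   half of [f p] to [x]. *)
pose d := f p / (2 * C).
have d0 : 0 < d by rewrite divr_gt0 // mulr_gt0.
have d1 : d < 1 by rewrite ltr_pdivrMr ?mulr_gt0 //; lra.
have dC : d * C = f p / 2 by rewrite /d; field; lra.
exists (f p / 2); first by rewrite divr_gt0.
near=> x.
have xpd : `|p - x| < d by near: x; apply: cvgr_dist_lt.
pose y := x + d^-1 *: (p - x).
(* One unit bounds [p - x], as [d < 1]; the other bounds [d^-1 *: (p - x)]. *)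
have yr : `|y| <= `|p| + 2.
  have -> : y = p - (p - x) + d^-1 *: (p - x) by rewrite opprB addrCA subrr addr0.
  apply: le_trans (ler_normD _ _) _.
  rewrite (_ : 2 = 1 + 1) // addrA lerD //.
    by apply: le_trans (ler_normB _ _) _; rewrite lerD2l ltW // (lt_trans xpd).
  by rewrite normrZ gtr0_norm ?invr_gt0 // mulrC ler_pdivrMr // mul1r ltW.
have pE : p = (1 - d) *: x + d *: y.
  rewrite /y scalerDr scalerA divff ?gt_eqF // scale1r addrA -scalerDl.
  by rewrite subrK scale1r addrC subrK.
have fp : f p <= (1 - d) * f x + d * f y.
  by rewrite {1}pE; apply: convex_functionT_le => //; lra.
have dfy : d * f y <= d * C by rewrite ler_pM2l // fC.
have fx : f p / 2 <= (1 - d) * f x by lra.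
have fx0 : 0 < f x by rewrite -(pmulr_rgt0 _ (_ : 0 < 1 - d)); lra.
by apply: le_trans fx _; rewrite ler_piMl ?ltW //; lra.
Unshelve. all: by end_near.
Qed.


Lemma compact_sphere (R : realType) (n : nat) (r : R) :
  compact [set x : 'rV[R]_n | `|x| = r].
Proof.
apply: bounded_closed_compact.
  by exists r; split; rewrite ?num_real // => M /ltW rM x /= ->.
apply: (@closed_comp _ _ (fun x : 'rV[R]_n => `|x|) [set r]).
  by move=> x _; exact: norm_continuous.
exact: closed_eq.
Qed.

(** Transfers growth of the Euclidean norm to the sup norm, in which the compactness argument is
    carried out. *)
Lemma enorm_le (R : realType) (n : nat) (x : 'rV[R]_n) :
  enorm x <= Num.sqrt n%:R * `|x|.
Proof.
rewrite -[`|x|]ger0_norm // -sqrtr_sqr -sqrtrM ?ler0n // ler_wsqrtr //.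
have -> : n%:R * `|x| ^+ 2 = \sum_(i < n) `|x| ^+ 2.
  by rewrite sumr_const card_ord mulr_natl.
rewrite ler_sum // => i _.
rewrite -real_normK ?num_real // lerXn2r ?nnegrE // [`|x|]mx_normrE.
exact: (le_bigmax _ (fun ij => `|x ij.1 ij.2|) (ord0, i)).
Qed.

(** Local positive lower bounds replace continuity of [f]: by compactness, all small enough [m > 0]
    work at once. *)
Lemma compact_convex_pos (R : realType) (n : nat) (f : 'rV[R]_n -> R)
    (K : set 'rV[R]_n) :
  convex_function [set: 'rV[R]_n] f -> compact K ->
  (forall x, K x -> 0 < f x) ->
  exists2 m, 0 < m & forall x, K x -> m <= f x.
Proof.
move=> cf /compact_near_coveringP cK fK.
have mK : \forall m \near (0 : R)^'+, K `<=` [set x | m <= f x].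
  apply: cK => p /fK /(convex_pos_near cf)[m m0 mf].
  near=> x e => /=; apply: (@le_trans _ _ m); last by near: x.
  by near: e; exact: nbhs_right_le.
have m0 : \forall m \near (0 : R)^'+, 0 < m by exact: nbhs_right_gt.
by have [m [? ?]] := filter_ex (filterI m0 mK); exists m.
Unshelve. all: by end_near.
Qed.

Theorem lemma4p1 (R : realType) (n : nat) (V : 'rV[R]_n -> R)
    (V0 : V 0 = 0)
    (Vpos : forall x : 'rV[R]_n, x != 0 -> 0 < V x)
    (Vconvex : convex_function [set: 'rV[R]_n] V) :
  radially_unbounded V.
Proof.
have [x /= x1|m m0 mV] := compact_convex_pos Vconvex (@compact_sphere R n 1).
  by apply: Vpos; rewrite -normr_gt0 x1.
apply/radially_unboundedP => M.
(* The bound [1] makes [|x|^-1] a convex weight; the other gives [|x| * m > |M| + 1]. *)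
pose t := Num.max 1 ((`|M| + 1) / m).
exists (Num.sqrt n%:R * t) => x /lt_le_trans /(_ (enorm_le x)) nx.
have tx : t < `|x|.
  (* Arguing by contradiction avoids dividing by [Num.sqrt n%:R], which is zero for [n = 0]. *)
  by rewrite ltNge; apply/negP => /(ler_wpM2l (sqrtr_ge0 n%:R)); rewrite leNgt nx.
move: tx; rewrite gt_max => /andP[x1 xM].
have x0 : 0 < `|x| by exact: lt_trans x1.
have xV0 : 0 <= `|x|^-1 by rewrite invr_ge0.
have xV1 : `|x|^-1 <= 1 by rewrite invf_le1 // ltW.
have Vx : V (`|x|^-1 *: x) <= `|x|^-1 * V x.
  have := convex_functionT_le x 0 Vconvex xV0 (_ : 0 <= 1 - `|x|^-1).
  by rewrite scaler0 V0 mulr0 !addr0 subr_ge0 addrC subrK; apply.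
have mx : m <= `|x|^-1 * V x.
  apply: le_trans Vx; apply: mV => /=.
  by rewrite normrZ ger0_norm // mulVf // gt_eqF.
have {}mx : `|x| * m <= V x by rewrite mulrC -ler_pdivlMr // mulrC.
apply: lt_le_trans mx; rewrite ltr_pdivrMr // in xM.
by apply: le_lt_trans xM; rewrite (le_trans (ler_norm M)) // lerDl.
Qed.
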